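(* If $n=4s\ge 16$ for a positive integer $s$, then $C_3(\mathcal{N}_n)$ is reducible.
   Context: $k$ is an algebraically closed field and $\mathcal{N}_n$ is the variety of nilpotent $n\times n$ matrices over $k$, a closed subvariety of the affine space $\mathfrak{gl}_n$ of $n\times n$ matrices. $C_3(\mathcal{N}_n)=\{(v_1,v_2,v_3)\in(\mathcal{N}_n)^3 : [v_i,v_j]=0 \text{ for all } i,j\}$, with the Zariski topology. Reducible means not irreducible as a topological space. *)

(* Defs.v *)
From mathcomp Require Import all_boot all_order all_algebra.
From mathcomp Require Export mpoly.

Set Implicit Arguments.
Unset Strict Implicit.
Unset Printing Implicit Defensive.

Import GRing.Theory.
Local Open Scope ring_scope.

(* The topology on the ambient type T is given by its closed sets, and X
   carries the subspace topology: its closed subsets are the intersections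
   X /\ Z with Z closed in T. *)
Definition irreducible (T : Type) (closed : (T -> Prop) -> Prop)
    (X : T -> Prop) : Prop :=
  (exists x, X x) /\
  forall Z1 Z2 : T -> Prop, closed Z1 -> closed Z2 ->
    (forall x, X x -> Z1 x \/ Z2 x) ->
    (forall x, X x -> Z1 x) \/ (forall x, X x -> Z2 x).

Section CommutingNilpotent.
Variables (k : fieldType) (d n : nat).

(* d-tuples of n x n matrices form an affine space of dimension d * n * n:
   one coordinate for each triple (index in the tuple, row, column). *)
Definition mxtuple_coord (v : {ffun 'I_d -> 'M[k]_n}) :
    'I_#|{: 'I_d * 'I_n * 'I_n}| -> k :=
  fun t => let: (a, i, j) := enum_val t in v a i j.

Definition zariski_closed (Z : {ffun 'I_d -> 'M[k]_n} -> Prop) : Prop :=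
  exists S : {mpoly k[#|{: 'I_d * 'I_n * 'I_n}|]} -> Prop,
    forall v, Z v <-> (forall p, S p -> p.@[mxtuple_coord v] = 0).

Definition nilpotent_mx (A : 'M[k]_n) : Prop := exists m : nat, A ^+ m = 0.

Definition commuting_nilpotent (v : {ffun 'I_d -> 'M[k]_n}) : Prop :=
  (forall a, nilpotent_mx (v a)) /\
  (forall a b, v a *m v b - v b *m v a = 0).

End CommutingNilpotent.

(* Main.v *)
(*
Write n = 4s.  A triple whose first entry v_1 is nilpotent with cyclic vector
e_1 is determined by the Krylov basis (e_1, v_1 e_1, v_1^2 e_1, ...) and by the
coefficients of v_2 and v_3 as polynomials in v_1 without constant term, i.e.
by n(n-1) + 2(n-1) = n^2 + n - 2 parameters.  Hence any n^2 + n - 1 coordinates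
of such a triple satisfy a common nonzero polynomial relation.

On the other hand, consider the conjugates of triples of block matrices
[[0,B,C],[0,0,A],[0,0,0]] with blocks of sizes s, 2s, s and B_i A_j = B_j A_i.
This family contains a triple with prescribed generic values of 17 s^2 suitable
coordinates, so these coordinates satisfy no polynomial relation on C_3(N_n).
For s >= 4 one has 17 s^2 > n^2 + n - 2, so C_3(N_n) is the union of two proper
closed subsets: the zero locus of a relation among these 17 s^2 coordinates
that holds when e_1 is cyclic for v_1, and the locus where e_1 is not cyclic.
*)
Require Import Defs.
From mathcomp Require Import all_boot all_order all_algebra.
From mathcomp Require Import zify.

Set Implicit Arguments.
Unset Strict Implicit.
Unset Printing Implicit Defensive.

Import GRing.Theory.
Local Open Scope ring_scope.

(** * Polynomials in several variables *)

(* A closed field is infinite: a root of p * 'X + 1 is not a root of p. *)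
Lemma closed_field_poly_nonroot (k : closedFieldType) (p : {poly k}) :
  p != 0 -> exists t, p.[t] != 0.
Proof.
move=> p0; case: (eqVneq (size p) 1%N) => [/eqP/size_poly1P[c c0 ->]|sp].
  by exists 0; rewrite hornerC.
have sz : size (p * 'X + 1) = (size p).+1.
  have sX : size (p * 'X) = (size p).+1 by rewrite size_mulX.
  by rewrite size_polyDl sX // size_poly1 ltnS size_poly_gt0.
have /closed_rootP[t /rootP] : size (p * 'X + 1) != 1%N.
  by rewrite sz eqSS size_poly_eq0.
rewrite hornerD hornerMX hornerC => e; exists t; apply/eqP => pt.
by move/eqP: e; rewrite pt mul0r add0r oner_eq0.
Qed.

(** Regarding p as univariate in its last variable loses no coefficient; hence [muni p] is nonzero
    when p is. *)
Lemma mcoeff_muni (R : nzRingType) n (p : {mpoly R[n.+1]}) (m : 'X_{1..n.+1}) :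
  ((muni p)`_(m ord_max))@_[multinom m (widen_ord (leqnSn n) i) | i < n] = p@_m.
Proof.
rewrite muniE coef_sum raddf_sum /= [in RHS](mpolyE p) raddf_sum /=.
apply: eq_bigr => m' _.
rewrite coefZ coefXn -mul_mpolyC -mulrA mcoeffCM mcoeffZ mcoeffX; congr (_ * _).
case: (eqVneq m' m) => [->|ne]; first by rewrite eqxx mulr1 mcoeffX eqxx.
case: eqP => [e|_]; last by rewrite mulr0 mcoeff0.
rewrite mulr1 mcoeffX; case: eqP => // /mnmP h; case/eqP: ne.
apply/mnmP => i; case: (unliftP ord_max i) => [j ->|->]; last by rewrite e.
have := h j; rewrite !mnmE; suff -> : widen_ord (leqnSn n) j = lift ord_max j by [].
by apply/val_inj; rewrite [RHS]lift_max.
Qed.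

(** Induction on the number of variables: at a point where the leading coefficient in the last
    variable does not vanish, a nonzero univariate polynomial remains. *)
Lemma mpoly_nonroot (k : closedFieldType) n (p : {mpoly k[n]}) :
  p != 0 -> exists c, p.@[c] != 0.
Proof.
elim: n p => [|n IHn] p p0.
  exists (fun=> 0); have e : (msize p <= 1)%N.
    rewrite msizeE; apply/bigmax_leqP_seq => m _ _.
    by rewrite mdegE big_ord0.
  rewrite (msize1_polyC e) mevalC; apply: contraNneq p0 => e0.
  by rewrite (msize1_polyC e) e0.
have u0 : muni p != 0.
  apply: contraNneq p0 => u0; apply/eqP/mpolyP => m.
  by rewrite -mcoeff_muni u0 coef0 !mcoeff0.
have [c hc] : exists c, (lead_coef (muni p)).@[c] != 0 by apply: IHn; rewrite lead_coef_eq0.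
have q0 : map_poly (meval c) (muni p) != 0.
  by rewrite -lead_coef_eq0 lead_coef_map_eq.
have [t ht] := closed_field_poly_nonroot q0.
exists (fun i => if unlift ord_max i is Some j then c j else t).
apply: contraNneq ht => e; apply/eqP; rewrite -[RHS]e muniE mevalE.
rewrite raddf_sum horner_sum; apply: eq_bigr => m _ /=.
rewrite -!mul_polyC rmorphM /= map_polyC /= map_polyXn hornerCM hornerXn.
rewrite mevalZ -mulrA; congr (_ * _).
rewrite big_ord_recr /= mevalX unlift_none; congr (_ * _).
apply: eq_bigr => i _; rewrite mnmE.
have -> : widen_ord (leqnSn n) i = lift ord_max i.
  by apply/val_inj; rewrite [RHS]lift_max.
by rewrite liftK.
Qed.

(** * Algebraic dependence by counting monomials *)

(* Sharper than msizeM_le, whose bound does not iterate linearly. *)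
Lemma msizeM_le_pred (R : idomainType) n (p q : {mpoly R[n]}) :
  (msize (p * q)%R <= (msize p + msize q).-1)%N.
Proof.
have [->|p0] := eqVneq p 0; first by rewrite mul0r msize0.
have [->|q0] := eqVneq q 0; first by rewrite mulr0 msize0.
by rewrite msizeM.
Qed.

(** The size of a nonzero polynomial is its total degree plus one, so e bounds a degree and degree
    bounds multiply. *)
Lemma msize_exp_le (R : idomainType) n (p : {mpoly R[n]}) e d :
  (msize p <= e.+1 -> msize (p ^+ d)%R <= (d * e).+1)%N.
Proof.
move=> hp; elim: d => [|d IH]; first by rewrite expr0 msize1.
by rewrite exprS; apply: leq_trans (msizeM_le_pred _ _) _; lia.
Qed.

Lemma msize_prod_le (R : idomainType) n (I : finType) (p : I -> {mpoly R[n]}) e :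
  (forall i, msize (p i) <= e.+1)%N -> (msize (\prod_i p i)%R <= (#|I| * e).+1)%N.
Proof.
move=> hp; have H (r : seq I) : (msize (\prod_(i <- r) p i)%R <= (size r * e).+1)%N.
  elim: r => [|i r IH]; first by rewrite big_nil msize1.
  rewrite big_cons; apply: leq_trans (msizeM_le_pred _ _) _; rewrite /= mulSn.
  by move: (hp i) IH; set A := msize _; set B := msize _; lia.
by have := H (index_enum I); rewrite cardT enumT [index_enum _]unlock.
Qed.

Lemma wide_matrix_ker (F : fieldType) m n (A : 'M[F]_(m, n)) :
  (n < m)%N -> exists2 x : 'rV_m, x != 0 & x *m A = 0.
Proof.
move=> nm; have : kermx A != 0.
  rewrite kermx_eq0 /row_free neq_ltn (leq_ltn_trans (rank_leq_col A)) //.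
case/rowV0Pn => x /sub_kermxP xA x0; exists x => //.
Qed.

(** The left side grows like D^m and the right side like D^N. Since N D e + 1 is at most (N e + 1)(D
    + 1), the choice D = (N e + 1)^m suffices. *)
Lemma box_count N m e : (m < N)%N ->
  exists D, ((N * D * e).+1 ^ m < D.+1 ^ N)%N.
Proof.
move=> mN; set D := ((N * e).+1 ^ m)%N; exists D.
have h1 : ((N * D * e).+1 ^ m <= (N * e).+1 ^ m * D.+1 ^ m)%N.
  rewrite -expnMn.
  have [->|m0] := posnP m; first by rewrite !expn0.
  rewrite leq_exp2r //.
  have -> : ((N * e).+1 * D.+1 = N * D * e + N * e + D.+1)%N by lia.
  lia.
apply: leq_ltn_trans h1 _; apply: (@leq_trans (D.+1 ^ m.+1)%N).
  by rewrite expnS ltn_pmul2r // expn_gt0.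
by rewrite leq_pexp2l.
Qed.

(** Each exponent is bounded separately, rather than the total degree, so that the number of
    monomials is a plain power. *)
Definition box_mnm n d (a : {ffun 'I_n -> 'I_d}) : 'X_{1..n} :=
  [multinom (a i : nat) | i < n].

Lemma box_mnm_inj n d : injective (@box_mnm n d).
Proof.
move=> a b /mnmP h; apply/ffunP => i; apply/val_inj.
by have := h i; rewrite !mnmE.
Qed.

(* Compare the (D + 1)^N monomials in the g_j, multiplied by delta^(N D), with
   the space of polynomials in m < N variables whose degrees grow linearly in D. *)
Lemma algebraic_dependence (F : fieldType) m N
    (delta : {mpoly F[m]}) (g : 'I_N -> {mpoly F[m]}) :
  (m < N)%N ->
  exists2 P : {mpoly F[N]}, P != 0 &
    forall u, delta.@[u] != 0 -> P.@[fun j => (g j).@[u] / delta.@[u]] = 0.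
Proof.
move=> mN; pose e := maxn (msize delta) (\max_j msize (g j)).
have [D hD] := box_count e mN.
(* This is the monomial of exponent a in the g_j / delta, cleared of denominators by delta^(N D). *)
pose Q (a : {ffun 'I_N -> 'I_D.+1}) : {mpoly F[m]} :=
  \prod_j (g j ^+ a j * delta ^+ (D - a j)).
have szQ a : (msize (Q a) <= (N * D * e).+1)%N.
  rewrite -mulnA -[X in (X * _)%N](card_ord N); apply: msize_prod_le => j.
  have sg : (msize (g j) <= e.+1)%N.
    apply: leqW; rewrite /e leq_max; apply/orP; right.
    exact: (@leq_bigmax _ (fun j => msize (g j))).
  have sd : (msize delta <= e.+1)%N by apply: leqW; rewrite leq_max leqnn.
  have h1 := msize_exp_le (a j) sg; have h2 := msize_exp_le (D - a j) sd.
  apply: leq_trans (msizeM_le_pred _ _) _.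
  have aD : (a j <= D)%N by rewrite -ltnS.
  have : (a j * e + (D - a j) * e = D * e)%N by rewrite -mulnDl subnKC.
  move: h1 h2; set A := msize _; set B := msize _; lia.
pose BN : finType := {ffun 'I_N -> 'I_D.+1}.
pose Bm : finType := {ffun 'I_m -> 'I_(N * D * e).+1}.
(* The rows hold the coefficients of the Q a; there are more rows than columns, so the Q a are
   linearly dependent. *)
pose A : 'M[F]_(#|BN|, #|Bm|) :=
  \matrix_(i, j) (Q (enum_val i))@_(box_mnm (enum_val j)).
have [|x x0 xA] := @wide_matrix_ker _ _ _ A.
  by rewrite !card_ffun !card_ord.
have Q0 : \sum_i x 0 i *: Q (enum_val i) = 0.
  apply/mpolyP => mn; rewrite mcoeff0 raddf_sum /=.
  have [small|] := boolP [forall i, (mn i < (N * D * e).+1)%N].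
    pose b : Bm := [ffun i => inord (mn i)].
    have bE : box_mnm b = mn.
      apply/mnmP => i; rewrite mnmE ffunE inordK //.
      by move/forallP: small; apply.
    have /matrixP/(_ 0 (enum_rank b)) := xA.
    rewrite !mxE => h; rewrite -[RHS]h.
    by apply: eq_bigr => i _; rewrite mxE enum_rankK bE mcoeffZ.
  (* A monomial outside the box has degree above N D e and occurs in no Q a. *)
  rewrite negb_forall => /existsP[j]; rewrite -leqNgt => hj.
  apply: big1 => i _; rewrite mcoeffZ.
  suff /eqP -> : (Q (enum_val i))@_mn == 0 by rewrite mulr0.
  rewrite mcoeff_eq0 msize_mdeg_ge //.
  apply: leq_trans (szQ _) _; apply: leq_trans hj _.
  by rewrite mdegE (bigD1 j) //= leq_addr.
exists (\sum_i x 0 i *: 'X_[box_mnm (enum_val i : BN)]).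
  apply: contraNneq x0 => P0; apply/eqP/rowP => i; rewrite mxE.
  have /(congr1 (mcoeff (box_mnm (enum_val i : BN)))) := P0.
  rewrite raddf_sum /= mcoeff0 (bigD1 i) //= big1 => [|l li].
    by rewrite mcoeffZ mcoeffX eqxx mulr1 addr0.
  rewrite mcoeffZ mcoeffX (inj_eq (@box_mnm_inj _ _)) (inj_eq enum_val_inj).
  by rewrite (negbTE li) mulr0.
move=> u d0; apply: (mulIf (expf_neq0 (N * D) d0)); rewrite mul0r.
have /(congr1 (meval u)) := Q0; rewrite meval0 => h; rewrite -[RHS]h.
rewrite !raddf_sum mulr_suml; apply: eq_bigr => i _ /=.
rewrite !mevalZ -mulrA; congr (_ * _); rewrite mevalX rmorph_prod /=.
rewrite mulnC exprM.
have -> : (delta.@[u] ^+ D) ^+ N = \prod_(j < N) delta.@[u] ^+ D.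
  by rewrite prodr_const card_ord.
rewrite -big_split; apply: eq_bigr => j _ /=.
rewrite mnmE rmorphM !rmorphXn /=; set a := enum_val i j.
have aD : (a <= D)%N by rewrite -ltnS.
have -> : delta.@[u] ^+ D = delta.@[u] ^+ a * delta.@[u] ^+ (D - a).
  by rewrite -exprD subnKC.
by rewrite mulrA -exprMn divfK.
Qed.

(** * Germs of rational functions at a point of affine space *)

Section Regular.
Variables (F : fieldType) (N : nat) (c0 : 'I_N -> F).

(** Neighbourhoods of [c0] are principal open sets, given by their equation h. *)
Definition near (Q : ('I_N -> F) -> Prop) : Prop :=
  exists2 h : {mpoly F[N]}, h.@[c0] != 0 & forall c, h.@[c] != 0 -> Q c.

(** The function f is total, but its values where the denominator vanishes are left free; this
    absorbs the default values of inverses. *)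
Definition regular (f : ('I_N -> F) -> F) : Prop :=
  exists2 pq : {mpoly F[N]} * {mpoly F[N]}, pq.2.@[c0] != 0 &
    forall c, pq.2.@[c] != 0 -> f c = pq.1.@[c] / pq.2.@[c].

Lemma near_sub (Q Q' : ('I_N -> F) -> Prop) :
  (forall c, Q c -> Q' c) -> near Q -> near Q'.
Proof. by move=> QQ' [h h0 hQ]; exists h => // c /hQ/QQ'. Qed.

Lemma near_and (Q Q' : ('I_N -> F) -> Prop) :
  near Q -> near Q' -> near (fun c => Q c /\ Q' c).
Proof.
move=> [h h0 hQ] [h' h'0 hQ']; exists (h * h').
  by rewrite mevalM mulf_neq0.
by move=> c; rewrite mevalM mulf_eq0 negb_or => /andP[/hQ ? /hQ' ?].
Qed.

Lemma regular_near (f g : ('I_N -> F) -> F) :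
  near (fun c => f c = g c) -> regular g -> regular f.
Proof.
move=> [h h0 hQ] [[p q] /= q0 hpq]; exists (p * h, q * h) => /=.
  by rewrite mevalM mulf_neq0.
move=> c; rewrite !mevalM mulf_eq0 negb_or => /andP[qc hc].
by rewrite hQ // hpq // -mulf_div divff // mulr1.
Qed.

Lemma regular_neq0 f : regular f -> f c0 != 0 -> near (fun c => f c != 0).
Proof.
move=> [[p q] /= q0 hpq]; rewrite hpq // mulf_eq0 negb_or => /andP[p0 _].
exists (p * q); first by rewrite mevalM mulf_neq0.
move=> c; rewrite mevalM mulf_eq0 negb_or => /andP[pc qc].
by rewrite hpq // mulf_neq0 // invr_eq0.
Qed.

Lemma regular_cst a : regular (fun=> a).
Proof.
exists (a%:MP, 1) => [|c _] /=; first by rewrite meval1 oner_neq0.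
by rewrite mevalC meval1 divr1.
Qed.

Lemma regular_coord i : regular (fun c => c i).
Proof.
exists ('X_i, 1) => [|c _] /=; first by rewrite meval1 oner_neq0.
by rewrite mevalXU meval1 divr1.
Qed.

Lemma regularD f g : regular f -> regular g -> regular (fun c => f c + g c).
Proof.
move=> [[p q] /= q0 hpq] [[p' q'] /= q'0 hpq'].
exists (p * q' + p' * q, q * q') => [|c] /=; first by rewrite mevalM mulf_neq0.
rewrite mevalM mulf_eq0 negb_or => /andP[qc q'c].
by rewrite hpq // hpq' // addf_div // mevalD !mevalM.
Qed.

Lemma regularM f g : regular f -> regular g -> regular (fun c => f c * g c).
Proof.
move=> [[p q] /= q0 hpq] [[p' q'] /= q'0 hpq'].
exists (p * p', q * q') => [|c] /=; first by rewrite mevalM mulf_neq0.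
rewrite mevalM mulf_eq0 negb_or => /andP[qc q'c].
by rewrite hpq // hpq' // mulf_div !mevalM.
Qed.

Lemma regularV f : regular f -> f c0 != 0 -> regular (fun c => (f c)^-1).
Proof.
move=> [[p q] /= q0 hpq]; rewrite hpq // mulf_eq0 negb_or => /andP[p0 _].
(* The inverse q / p is written with denominator p q, so that q is nonzero too and the formula for f
   applies. *)
exists (q * q, p * q) => /=; first by rewrite mevalM mulf_neq0.
move=> c; rewrite !mevalM mulf_eq0 negb_or => /andP[pc qc].
by rewrite hpq // -mulf_div divff // mulr1 invf_div.
Qed.

Lemma eq_regular f g : f =1 g -> regular g -> regular f.
Proof. by move=> fg [pq q0 h]; exists pq => // c /h <-. Qed.

Lemma regular_sum (I : Type) (r : seq I) (P : pred I) f :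
  (forall i, regular (f i)) -> regular (fun c => \sum_(i <- r | P i) f i c).
Proof.
move=> hf; elim: r => [|i r IH].
  by apply: eq_regular (regular_cst 0) => c; rewrite big_nil.
have [Pi|nPi] := boolP (P i); last first.
  by apply: eq_regular IH => c; rewrite big_cons (negbTE nPi).
by apply: eq_regular (regularD (hf i) IH) => c; rewrite big_cons Pi.
Qed.

Lemma regular_prod (I : Type) (r : seq I) (P : pred I) f :
  (forall i, regular (f i)) -> regular (fun c => \prod_(i <- r | P i) f i c).
Proof.
move=> hf; elim: r => [|i r IH].
  by apply: eq_regular (regular_cst 1) => c; rewrite big_nil.
have [Pi|nPi] := boolP (P i); last first.
  by apply: eq_regular IH => c; rewrite big_cons (negbTE nPi).
by apply: eq_regular (regularM (hf i) IH) => c; rewrite big_cons Pi.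
Qed.

Definition regular_mx m n (M : ('I_N -> F) -> 'M[F]_(m, n)) : Prop :=
  forall i j, regular (fun c => M c i j).

Lemma regular_mxD m n (A B : ('I_N -> F) -> 'M_(m, n)) :
  regular_mx A -> regular_mx B -> regular_mx (fun c => A c + B c).
Proof.
move=> hA hB i j; apply: eq_regular (regularD (hA i j) (hB i j)) => c.
by rewrite mxE.
Qed.

Lemma regular_mxN m n (A : ('I_N -> F) -> 'M_(m, n)) :
  regular_mx A -> regular_mx (fun c => - A c).
Proof.
move=> hA i j; apply: eq_regular (regularM (regular_cst (-1)) (hA i j)) => c.
by rewrite mxE mulN1r.
Qed.

Lemma regular_mxM m n p (A : ('I_N -> F) -> 'M_(m, n))
    (B : ('I_N -> F) -> 'M_(n, p)) :
  regular_mx A -> regular_mx B -> regular_mx (fun c => A c *m B c).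
Proof.
move=> hA hB i j; apply: (@eq_regular _ (fun c => \sum_l A c i l * B c l j)).
  by move=> c; rewrite mxE.
by apply: regular_sum => l; apply: regularM.
Qed.

Lemma regular_row_mx m n p (A : ('I_N -> F) -> 'M_(m, n))
    (B : ('I_N -> F) -> 'M_(m, p)) :
  regular_mx A -> regular_mx B -> regular_mx (fun c => row_mx (A c) (B c)).
Proof.
move=> hA hB i j; case: (split_ordP j) => l ->.
  by apply: eq_regular (hA i l) => c; rewrite row_mxEl.
by apply: eq_regular (hB i l) => c; rewrite row_mxEr.
Qed.

Lemma regular_col_mx m n p (A : ('I_N -> F) -> 'M_(n, m))
    (B : ('I_N -> F) -> 'M_(p, m)) :
  regular_mx A -> regular_mx B -> regular_mx (fun c => col_mx (A c) (B c)).
Proof.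
move=> hA hB i j; case: (split_ordP i) => l ->.
  by apply: eq_regular (hA l j) => c; rewrite col_mxEu.
by apply: eq_regular (hB l j) => c; rewrite col_mxEd.
Qed.

Lemma regular_det n (A : ('I_N -> F) -> 'M_n) :
  regular_mx A -> regular (fun c => \det (A c)).
Proof.
move=> hA; apply: regular_sum => s; apply: regularM; first exact: regular_cst.
exact: regular_prod.
Qed.

Lemma near_unitmx n (A : ('I_N -> F) -> 'M_n) :
  regular_mx A -> A c0 \in unitmx -> near (fun c => A c \in unitmx).
Proof.
move=> /regular_det dA; rewrite unitmxE unitfE => /(regular_neq0 dA).
by apply: near_sub => c; rewrite unitmxE unitfE.
Qed.

(** Cramer's formula, valid only near [c0] because [invmx] returns its argument on a singular
    matrix. *)
Lemma regular_invmx n (A : ('I_N -> F) -> 'M_n) :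
  regular_mx A -> A c0 \in unitmx -> regular_mx (fun c => invmx (A c)).
Proof.
move=> hA u0 i j; have dA := regular_det hA.
apply: (@regular_near _ (fun c => (\det (A c))^-1 * \adj (A c) i j)).
  apply: near_sub (near_unitmx hA u0) => c uc.
  by rewrite /invmx uc mxE.
apply: regularM; first by apply: regularV; rewrite // -unitfE -unitmxE.
apply: (@eq_regular _ (fun c => (-1) ^+ (j + i) * \det (row' j (col' i (A c))))).
  by move=> c; rewrite mxE.
apply: regularM; first exact: regular_cst.
by apply: regular_det => a b; apply: eq_regular (hA (lift j a) (lift i b)) => c; rewrite !mxE.
Qed.

End Regular.

Section RegularSubmatrix.
Variables (F : fieldType) (N : nat) (c0 : 'I_N -> F).
Variables (m1 m2 n1 n2 : nat).

Lemma regular_lsubmx (A : ('I_N -> F) -> 'M_(m1, n1 + n2)) :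
  regular_mx c0 A -> regular_mx c0 (fun c => lsubmx (A c)).
Proof. by move=> hA i j; apply: eq_regular (hA i (lshift n2 j)) => c; rewrite mxE. Qed.

Lemma regular_rsubmx (A : ('I_N -> F) -> 'M_(m1, n1 + n2)) :
  regular_mx c0 A -> regular_mx c0 (fun c => rsubmx (A c)).
Proof. by move=> hA i j; apply: eq_regular (hA i (rshift n1 j)) => c; rewrite mxE. Qed.

Lemma regular_usubmx (A : ('I_N -> F) -> 'M_(m1 + m2, n1)) :
  regular_mx c0 A -> regular_mx c0 (fun c => usubmx (A c)).
Proof. by move=> hA i j; apply: eq_regular (hA (lshift m2 i) j) => c; rewrite mxE. Qed.

Lemma regular_dsubmx (A : ('I_N -> F) -> 'M_(m1 + m2, n1)) :
  regular_mx c0 A -> regular_mx c0 (fun c => dsubmx (A c)).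
Proof. by move=> hA i j; apply: eq_regular (hA (rshift m1 i) j) => c; rewrite mxE. Qed.

End RegularSubmatrix.

(** * Triples with a common three-step flag *)

Lemma ord3P (P : 'I_3 -> Prop) : P 0 -> P 1 -> P 2%:R -> forall a, P a.
Proof.
move=> P0 P1 P2 [[|[|[|//]]] lt_a].
- by rewrite (_ : Ordinal _ = 0) //; apply/val_inj.
- by rewrite (_ : Ordinal _ = 1) //; apply/val_inj.
- by rewrite (_ : Ordinal _ = 2%:R) //; apply/val_inj.
Qed.

Section FlagTriples.
Variables (F : fieldType) (s m : nat).
Local Notation n := (s + (m + s))%N.

Definition flag_mx (A : 'M[F]_(m, s)) (B : 'M[F]_(s, m)) (C : 'M[F]_s) : 'M[F]_n :=
  block_mx 0 (row_mx B C) 0 (block_mx 0 A 0 0).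

(** The unipotent matrices [[1,0,0],[x,1,0],[z,y,1]] move the standard flag through an open cell of
    its flag variety. *)
Definition flag_change (x : 'M[F]_(m, s)) (y : 'M[F]_(s, m)) (z : 'M[F]_s) : 'M[F]_n :=
  block_mx 1%:M 0 (col_mx x z) (block_mx 1%:M 0 y 1%:M).

(** Only the corner block survives in a product, so commutation means B A' = B' A. *)
Lemma flag_mxM A B C A' B' C' :
  flag_mx A B C *m flag_mx A' B' C' = block_mx 0 (row_mx 0 (B *m A')) 0 0.
Proof.
rewrite /flag_mx mulmx_block !mul0mx !mulmx0 !add0r mul_row_block !mulmx0.
by rewrite !addr0 mulmx_block !mul0mx !mulmx0 !addr0 block_mx0.
Qed.

Lemma flag_mx_cube A B C : flag_mx A B C *m flag_mx A B C *m flag_mx A B C = 0.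
Proof.
rewrite flag_mxM /flag_mx mulmx_block !mul0mx !mulmx0 !add0r.
by rewrite mul_row_block !mulmx0 !mul0mx !addr0 row_mx0 block_mx0.
Qed.

Lemma flag_changeK x y z :
  flag_change x y z *m flag_change (- x) (- y) (y *m x - z) = 1%:M.
Proof.
rewrite /flag_change mulmx_block !mul1mx !mul0mx !mulmx0 !addr0 !mulmx1.
rewrite mul_block_col !mul1mx mul0mx addr0 add_col_mx subrr mulmxN.
rewrite addKr subrr.
rewrite mulmx_block !mul1mx !mul0mx !mulmx0 !addr0 !mulmx1 !add0r subrr.
by rewrite col_mx0 -!scalar_mx_block.
Qed.

Definition flag_conj x y z A B C : 'M[F]_n :=
  flag_change x y z *m flag_mx A B C *m flag_change (- x) (- y) (y *m x - z).

(** The first block row of the left factor is (1,0,0), so only the right factor acts on the row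
    (0,B,C). *)
Lemma usubmx_flag_conj x y z A B C :
  usubmx (flag_conj x y z A B C) =
  row_mx (C *m (y *m x - z) - B *m x) (row_mx (B - C *m y) C).
Proof.
rewrite /flag_conj -!mul_usub_mx /flag_change {1}/block_mx col_mxKu.
rewrite /flag_mx mul_row_block !mul1mx !mul0mx !addr0 mul_row_block.
rewrite !mul0mx !add0r mul_row_col mul_row_block !mulmx1 mulmx0.
by rewrite !mulmxN add0r [- _ + C *m _]addrC.
Qed.

(** Dually, the last block column of the right factor is (0,0,1), so only the left factor acts on
    the column (C,A,0). *)
Lemma rsubmx_flag_conj x y z A B C :
  rsubmx (rsubmx (flag_conj x y z A B C)) =
  col_mx C (col_mx (A + x *m C) (y *m A + z *m C)).
Proof.
have e x' y' z' : rsubmx (rsubmx (flag_change x' y' z')) = col_mx 0 (col_mx 0 1%:M).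
  rewrite /flag_change block_mxEh row_mxKr block_mxEh -row_mx0 -block_mxEv.
  by rewrite block_mxEh row_mxKr.
rewrite /flag_conj -!mulmx_rsub e -mulmxA /flag_mx mul_block_col !mulmx0.
pose simpl0 := (mul0mx, mulmx0, add0r, addr0, mulmx1, mul1mx).
rewrite !simpl0 mul_row_col mul_block_col !simpl0.
rewrite /flag_change mul_block_col !simpl0 mul_block_col !simpl0.
by rewrite mul_col_mx add_col_mx [x *m _ + _]addrC [z *m _ + _]addrC.
Qed.

Lemma flag_conjM x y z A B C A' B' C' :
  flag_conj x y z A B C *m flag_conj x y z A' B' C' =
  flag_change x y z *m (flag_mx A B C *m flag_mx A' B' C')
    *m flag_change (- x) (- y) (y *m x - z).
Proof.
rewrite /flag_conj !mulmxA -(mulmxA _ _ (flag_change x y z)).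
by rewrite (mulmx1C (flag_changeK _ _ _)) mulmx1.
Qed.

Lemma flag_conj_commuting x y z (A : 'I_3 -> 'M_(m, s)) (B : 'I_3 -> 'M_(s, m))
    (C : 'I_3 -> 'M_s) :
  (forall a b, B a *m A b = B b *m A a) ->
  commuting_nilpotent [ffun a => flag_conj x y z (A a) (B a) (C a)].
Proof.
move=> BA; split=> [a|a b]; rewrite !ffunE.
  exists 3; rewrite !exprS expr0 mulr1 -!mulmxE mulmxA flag_conjM.
  rewrite -[flag_change x y z *m _ *m _]mulmxA /flag_conj !mulmxA.
  rewrite -(mulmxA _ _ (flag_change x y z)) (mulmx1C (flag_changeK _ _ _)) mulmx1.
  by rewrite -2!(mulmxA (flag_change x y z)) flag_mx_cube mulmx0 mul0mx.
by rewrite !flag_conjM !flag_mxM BA subrr.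
Qed.

End FlagTriples.

(** * Flag triples with 17 s^2 prescribed coordinates *)

Section Targets.
Variables (F : fieldType) (s : nat).
Local Notation n := (s + ((s + s) + s))%N.

(* The 17 s^2 prescribed coordinates, for n split into blocks s + ((s + s) + s):
   the last block column of all three matrices, then the blocks (1,1) and (1,2)
   of v_0, then the block (1,1) and the left half of the block (1,2) of v_1. *)
Definition target : finType :=
  ('I_3 * 'I_n * 'I_s + 'I_s * ('I_s + 'I_(s + s)) + 'I_s * ('I_s + 'I_s))%type.

Definition target_entry (j : target) : 'I_3 * 'I_n * 'I_n :=
  match j with
  | inl (inl (a, i, l)) => (a, i, rshift s (rshift (s + s) l))
  | inl (inr (i, inl l)) => (0, lshift _ i, lshift _ l)
  | inl (inr (i, inr l)) => (0, lshift _ i, rshift s (lshift s l))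
  | inr (i, inl l) => (1, lshift _ i, lshift _ l)
  | inr (i, inr l) => (1, lshift _ i, rshift s (lshift s (lshift s l)))
  end.

Implicit Type c : 'I_#|target| -> F.

Definition tcol a c : 'M[F]_(n, s) :=
  \matrix_(i, l) c (enum_rank (inl (inl (a, i, l)) : target)).
Definition tE0 c : 'M[F]_s :=
  \matrix_(i, l) c (enum_rank (inl (inr (i, inl l)) : target)).
Definition tB0 c : 'M[F]_(s, s + s) :=
  \matrix_(i, l) c (enum_rank (inl (inr (i, inr l)) : target)).
Definition tE1 c : 'M[F]_s :=
  \matrix_(i, l) c (enum_rank (inr (i, inl l) : target)).
Definition tP1 c : 'M[F]_s :=
  \matrix_(i, l) c (enum_rank (inr (i, inr l) : target)).
Definition tC a c := usubmx (tcol a c).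
Definition tA a c := usubmx (dsubmx (tcol a c)).
Definition tD a c := dsubmx (dsubmx (tcol a c)).

(* Recovering x, y, z, A, B, C from the prescribed entries.  With
   A'_a = A_a + x C_a, the last block row of the last block column is
   y A'_a + zeta C_a where zeta = z - y x, a linear system with matrix frame.
   With K_a = E_a + C_a zeta, the (1,1) blocks E_a give B_a x = - K_a, so that
   B_a A_b = B_a A'_b + K_a C_b does not involve x; the equation
   B_0 A_1 = B_1 A_0 then determines the right half Q_1 of B_1, after which x
   and finally B_2 are solutions of linear systems. *)
Definition frame c : 'M[F]_(s + (s + s)) :=
  row_mx (col_mx (tC 2%:R c) (tA 2%:R c))
    (row_mx (col_mx (tC 1 c) (tA 1 c)) (col_mx (tC 0 c) (tA 0 c))).
Definition coframe c : 'M[F]_(s, s + (s + s)) :=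
  row_mx (tD 2%:R c) (row_mx (tD 1 c) (tD 0 c)) *m invmx (frame c).
Definition sol_zeta c := lsubmx (coframe c).
Definition sol_y c := rsubmx (coframe c).
Definition sol_K0 c := tE0 c + tC 0 c *m sol_zeta c.
Definition sol_K1 c := tE1 c + tC 1 c *m sol_zeta c.
Definition sol_B0 c := tB0 c + tC 0 c *m sol_y c.
Definition sol_P1 c := tP1 c + tC 1 c *m lsubmx (sol_y c).
Definition sol_Q1 c :=
  (sol_B0 c *m tA 1 c + sol_K0 c *m tC 1 c - sol_P1 c *m usubmx (tA 0 c)
     - sol_K1 c *m tC 0 c) *m invmx (dsubmx (tA 0 c)).
Definition sol_B1 c := row_mx (sol_P1 c) (sol_Q1 c).
Definition sol_BB c : 'M[F]_(s + s) := col_mx (sol_B0 c) (sol_B1 c).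
Definition sol_x c := - (invmx (sol_BB c) *m col_mx (sol_K0 c) (sol_K1 c)).
Definition sol_A a c := tA a c - sol_x c *m tC a c.
Definition sol_AA c : 'M[F]_(s + s) := row_mx (sol_A 1 c) (sol_A 0 c).
Definition sol_B2 c :=
  row_mx (sol_B1 c *m sol_A 2%:R c) (sol_B0 c *m sol_A 2%:R c) *m invmx (sol_AA c).
Definition sol_B (a : 'I_3) c :=
  if a == 0 then sol_B0 c else if a == 1 then sol_B1 c else sol_B2 c.
Definition sol_z c := sol_zeta c + sol_y c *m sol_x c.

Definition solution c : {ffun 'I_3 -> 'M[F]_n} :=
  [ffun a => flag_conj (sol_x c) (sol_y c) (sol_z c) (sol_A a c) (sol_B a c) (tC a c)].

(** These are the four matrices inverted in the formulas above. *)
Definition solvable c : Prop :=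
  (frame c \in unitmx /\ dsubmx (tA 0 c) \in unitmx) /\
  (sol_BB c \in unitmx /\ sol_AA c \in unitmx).

Section Solvable.
Variable c : 'I_#|target| -> F.
Hypothesis c_solvable : solvable c.

Lemma sol_Bx : sol_B0 c *m sol_x c = - sol_K0 c /\ sol_B1 c *m sol_x c = - sol_K1 c.
Proof.
have [_ [uB _]] := c_solvable.
have : sol_BB c *m sol_x c = - col_mx (sol_K0 c) (sol_K1 c).
  by rewrite /sol_x mulmxN mulmxA mulmxV // mul1mx.
by rewrite /sol_BB mul_col_mx opp_col_mx => /eq_col_mx.
Qed.

(** For the pair (0,1), once x is eliminated by [sol_Bx], this is the equation defining [sol_Q1];
    for the pairs (2,1) and (2,0) it is the linear system solved by [sol_B2]. *)
Lemma sol_commute a b : sol_B a c *m sol_A b c = sol_B b c *m sol_A a c.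
Proof.
have [[_ uS] [_ uA]] := c_solvable; have [Bx0 Bx1] := sol_Bx.
have e01 : sol_B0 c *m sol_A 1 c = sol_B1 c *m sol_A 0 c.
  rewrite /sol_A !mulmxBr !mulmxA Bx0 Bx1 !mulNmx !opprK.
  rewrite -[tA 0 c in RHS]vsubmxK mul_row_col /sol_Q1 mulmxKV //.
  set u := sol_B0 c *m _; set v := sol_K0 c *m _; set w := sol_P1 c *m _.
  by rewrite [w + _]addrC addrAC subrK subrK.
have [e21 e20] : sol_B2 c *m sol_A 1 c = sol_B1 c *m sol_A 2%:R c /\
    sol_B2 c *m sol_A 0 c = sol_B0 c *m sol_A 2%:R c.
  by apply/eq_row_mx; rewrite -mul_mx_row /sol_B2 mulmxKV.
by elim/ord3P: a; elim/ord3P: b; rewrite /sol_B /=.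
Qed.

Lemma solution_commuting : commuting_nilpotent (solution c).
Proof. exact/flag_conj_commuting/sol_commute. Qed.

Lemma solution_target (j : target) :
  (let: (a, i, l) := target_entry j in solution c a i l) = c (enum_rank j).
Proof.
have [[uF _] _] := c_solvable; have [Bx0 Bx1] := sol_Bx.
have coframeE a : sol_y c *m tA a c + sol_zeta c *m tC a c = tD a c.
  have : coframe c *m frame c = row_mx (tD 2%:R c) (row_mx (tD 1 c) (tD 0 c)).
    by rewrite mulmxKV.
  rewrite /frame !mul_mx_row => /eq_row_mx[e2 /eq_row_mx[e1 e0]].
  have h b : coframe c *m col_mx (tC b c) (tA b c) = tD b c ->
      sol_y c *m tA b c + sol_zeta c *m tC b c = tD b c.
    by rewrite -{1}[coframe c]hsubmxK mul_row_col addrC.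
  by elim/ord3P: a; apply: h.
(* As z = zeta + y x and A = A' - x C, the block y A + z C equals y A' + zeta C. *)
have colE a : rsubmx (rsubmx (solution c a)) = tcol a c.
  rewrite ffunE rsubmx_flag_conj -[RHS]vsubmxK; congr col_mx.
  rewrite -[RHS]vsubmxK /sol_A subrK; congr col_mx.
  rewrite -[RHS]coframeE /sol_z mulmxBr mulmxDl mulmxA.
  by rewrite [X in _ + X]addrC addrA subrK.
(* Likewise C (y x - z) collapses to - C zeta. *)
have rowE a : usubmx (solution c a) =
    row_mx (- (tC a c *m sol_zeta c) - sol_B a c *m sol_x c)
      (row_mx (sol_B a c - tC a c *m sol_y c) (tC a c)).
  rewrite ffunE usubmx_flag_conj /sol_z mulmxBr mulmxDr.
  by rewrite [_ *m sol_zeta c + _]addrC opprD addNKr.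
have E0 : lsubmx (usubmx (solution c 0)) = tE0 c.
  by rewrite rowE row_mxKl /sol_B Bx0 opprK /sol_K0 addrC addrK.
have E1 : lsubmx (usubmx (solution c 1)) = tE1 c.
  by rewrite rowE row_mxKl /sol_B Bx1 opprK /sol_K1 addrC addrK.
have B0 : lsubmx (rsubmx (usubmx (solution c 0))) = tB0 c.
  by rewrite rowE row_mxKr row_mxKl /sol_B /sol_B0 addrK.
have P1 : lsubmx (lsubmx (rsubmx (usubmx (solution c 1)))) = tP1 c.
  rewrite rowE row_mxKr row_mxKl /sol_B linearB /=.
  by rewrite row_mxKl -mulmx_lsub /sol_P1 addrK.
case: j => [[[[a i] l]|[i [l|l]]]|[i [l|l]]] /=.
- by have /matrixP/(_ i l) := colE a; rewrite !mxE.
- by have /matrixP/(_ i l) := E0; rewrite !mxE.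
- by have /matrixP/(_ i l) := B0; rewrite !mxE.
- by have /matrixP/(_ i l) := E1; rewrite !mxE.
by have /matrixP/(_ i l) := P1; rewrite !mxE.
Qed.

End Solvable.

End Targets.

(** * Solvability on a nonempty open set *)

Section Witness.
Variables (F : fieldType) (s : nat).

(** The values are chosen so that all four matrices to be inverted become the identity. *)
Definition witness_col (a : 'I_3) : 'M[F]_(s + ((s + s) + s), s) :=
  if a == 0 then col_mx 0 (col_mx (col_mx 0 1%:M) 0)
  else if a == 1 then col_mx 0 (col_mx (col_mx 1%:M 0) 0)
  else col_mx 1%:M 0.

Definition witness (t : 'I_#|target s|) : F :=
  match enum_val t with
  | inl (inl (a, i, l)) => witness_col a i l
  | inl (inr (i, inr l)) => row_mx 1%:M 0 i l
  | _ => 0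
  end.

Lemma witness_tcol a : tcol a witness = witness_col a.
Proof. by apply/matrixP => i l; rewrite mxE /witness enum_rankK. Qed.

Lemma witness_tB0 : tB0 witness = row_mx 1%:M 0.
Proof. by apply/matrixP => i l; rewrite mxE /witness enum_rankK. Qed.

Lemma witness_tE0 : tE0 witness = 0.
Proof. by apply/matrixP => i l; rewrite !mxE /witness enum_rankK. Qed.

Lemma witness_tE1 : tE1 witness = 0.
Proof. by apply/matrixP => i l; rewrite !mxE /witness enum_rankK. Qed.

Lemma witness_tP1 : tP1 witness = 0.
Proof. by apply/matrixP => i l; rewrite !mxE /witness enum_rankK. Qed.

Lemma witness_tC a : tC a witness = if a == 2%:R then 1%:M else 0.
Proof. by rewrite /tC witness_tcol; elim/ord3P: a; rewrite /witness_col /= col_mxKu. Qed.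

Lemma witness_tA a : tA a witness =
  if a == 0 then col_mx 0 1%:M else if a == 1 then col_mx 1%:M 0 else 0.
Proof.
rewrite /tA witness_tcol; elim/ord3P: a; rewrite /witness_col /= col_mxKd ?col_mxKu //.
exact: linear0.
Qed.

Lemma witness_tD a : tD a witness = 0.
Proof.
rewrite /tD witness_tcol; elim/ord3P: a; rewrite /witness_col /= col_mxKd ?col_mxKd //.
exact: linear0.
Qed.

Lemma witness_frame : frame witness = 1%:M.
Proof.
rewrite /frame !witness_tC !witness_tA /=.
rewrite -[X in row_mx _ X]block_mxEh block_mxEv row_mx0 -!block_mxEh.
by rewrite -!scalar_mx_block.
Qed.

Lemma witness_solvable : solvable witness.
Proof.
have coframe0 : coframe witness = 0.
  by rewrite /coframe !witness_tD !row_mx0 mul0mx.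
have zeta0 : sol_zeta witness = 0 by rewrite /sol_zeta coframe0 linear0.
have y0 : sol_y witness = 0 by rewrite /sol_y coframe0 linear0.
have uS : dsubmx (tA 0 witness) = 1%:M by rewrite witness_tA /= col_mxKd.
have B0 : sol_B0 witness = row_mx 1%:M 0.
  by rewrite /sol_B0 y0 mulmx0 addr0 witness_tB0.
have K0 : sol_K0 witness = 0 by rewrite /sol_K0 zeta0 mulmx0 addr0 witness_tE0.
have K1 : sol_K1 witness = 0 by rewrite /sol_K1 zeta0 mulmx0 addr0 witness_tE1.
have P1 : sol_P1 witness = 0.
  by rewrite /sol_P1 y0 linear0 mulmx0 addr0 witness_tP1.
have Q1 : sol_Q1 witness = 1%:M.
  rewrite /sol_Q1 B0 K0 K1 P1 uS invmx1 mulmx1 witness_tA /= !mul0mx addr0 !subr0.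
  by rewrite mul_row_col mul1mx mulmx0 addr0.
have BB : sol_BB witness = 1%:M.
  by rewrite /sol_BB /sol_B1 B0 P1 Q1 -block_mxEv -scalar_mx_block.
have x0 : sol_x witness = 0.
  by rewrite /sol_x K0 K1 col_mx0 mulmx0 oppr0.
have AA : sol_AA witness = 1%:M.
  rewrite /sol_AA /sol_A x0 !mul0mx !subr0 !witness_tA /=.
  by rewrite -block_mxEh -scalar_mx_block.
by rewrite /solvable witness_frame uS BB AA !unitmx1.
Qed.

Let reg := regular_mx witness.

Lemma regular_tcol a : reg (tcol a).
Proof. by move=> i l; apply: eq_regular (regular_coord _ _) => c; rewrite mxE. Qed.

(** Every intermediate matrix is regular at the witness, where the four matrices are invertible, so
    they stay invertible nearby. *)
Lemma near_solvable : near witness (@solvable F s).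
Proof.
have [[uF uS] [uB uA]] := witness_solvable.
have rC a : reg (tC a) by apply/regular_usubmx/regular_tcol.
have rA a : reg (tA a) by apply/regular_usubmx/regular_dsubmx/regular_tcol.
have rD a : reg (tD a) by apply/regular_dsubmx/regular_dsubmx/regular_tcol.
have rE0 : reg (@tE0 F s).
  by move=> i l; apply: eq_regular (regular_coord _ _) => c; rewrite mxE.
have rE1 : reg (@tE1 F s).
  by move=> i l; apply: eq_regular (regular_coord _ _) => c; rewrite mxE.
have rB0' : reg (@tB0 F s).
  by move=> i l; apply: eq_regular (regular_coord _ _) => c; rewrite mxE.
have rP1' : reg (@tP1 F s).
  by move=> i l; apply: eq_regular (regular_coord _ _) => c; rewrite mxE.
have rF : reg (@frame F s).
  apply: regular_row_mx; last apply: regular_row_mx; apply: regular_col_mx;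
    by [apply: rC | apply: rA].
have rcF : reg (@coframe F s).
  by apply: regular_mxM; [do !apply: regular_row_mx; apply: rD | apply: regular_invmx].
have rz : reg (@sol_zeta F s) by apply: regular_lsubmx.
have ry : reg (@sol_y F s) by apply: regular_rsubmx.
have rK0 : reg (@sol_K0 F s)
  by apply: regular_mxD => //; apply: regular_mxM => //; apply: rC.
have rK1 : reg (@sol_K1 F s)
  by apply: regular_mxD => //; apply: regular_mxM => //; apply: rC.
have rB0 : reg (@sol_B0 F s)
  by apply: regular_mxD => //; apply: regular_mxM => //; apply: rC.
have rP1 : reg (@sol_P1 F s).
  by apply: regular_mxD => //; apply: regular_mxM; [apply: rC | apply: regular_lsubmx].
have rQ1 : reg (@sol_Q1 F s).
  apply: regular_mxM; last by apply: regular_invmx => //; apply: regular_dsubmx; apply: rA.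
  by do !(assumption || apply: rC || apply: rA || apply: regular_usubmx || apply: regular_mxD
    || apply: regular_mxN || apply: regular_mxM).
have rB1 : reg (@sol_B1 F s) by apply: regular_row_mx.
have rBB : reg (@sol_BB F s) by apply: regular_col_mx.
have rx : reg (@sol_x F s).
  by apply/regular_mxN/regular_mxM; [apply: regular_invmx | apply: regular_col_mx].
have rsA a : reg (sol_A a).
  by apply: regular_mxD; [apply: rA | apply/regular_mxN/regular_mxM; last apply: rC].
have rAA : reg (@sol_AA F s) by apply: regular_row_mx; apply: rsA.
apply: near_and; apply: near_and; apply: near_unitmx => //.
by apply: regular_dsubmx; apply: rA.
Qed.

End Witness.

(** Otherwise the product of P with the equation h of the open set is nonzero at some point, which
    is solvable without being a zero of P. *)
Lemma generic_target_vanish (k : closedFieldType) (s : nat) (P : {mpoly k[#|target s|]}) :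
  (forall c, solvable c -> P.@[c] = 0) -> P = 0.
Proof.
move=> P0; have [h h0 hs] := near_solvable k s.
have [//|Pn0] := eqVneq P 0.
have hn0 : h != 0 by apply: contraNneq h0 => ->; rewrite meval0.
have [c] := mpoly_nonroot (mulf_neq0 Pn0 hn0).
rewrite mevalM mulf_eq0 negb_or => /andP[Pc /hs/P0 e].
by rewrite e eqxx in Pc.
Qed.

(** * Triples whose first entry has a cyclic vector *)

(** The minimal polynomial divides a power of 'X, hence is 'X^d, and d is at most n because it
    divides the characteristic polynomial. *)
Lemma nilpotent_mx_exp (F : fieldType) n (A : 'M[F]_n) : nilpotent_mx A -> A ^+ n = 0.
Proof.
case: n A => [|n] A [m Am]; first by rewrite [LHS]thinmx0 [RHS]thinmx0.
have : mxminpoly A %| ('X - 0%:P) ^+ m.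
  by apply/mxminpoly_min; rewrite subr0 rmorphXn /= horner_mx_X.
case/dvdp_exp_XsubCP => d _; rewrite subr0.
rewrite eqp_monic ?mxminpoly_monic ?monicXn // => /eqP e.
have dn : (d <= n.+1)%N.
  have := dvdp_leq (monic_neq0 (char_poly_monic A)) (mxminpoly_dvd_char A).
  by rewrite e size_polyXn size_char_poly.
have := mx_root_minpoly A; rewrite e rmorphXn /= horner_mx_X => Ad.
by rewrite -[X in A ^+ X](subnK dn) exprD Ad mulr0.
Qed.

Section Krylov.
Variables (n : nat) (i0 : 'I_n).
Hypothesis i0_eq0 : i0 = 0%N :> nat.

(** The nilpotent Jordan block sending each basis vector to the next one. The ring is general in
    order to allow polynomial entries. *)
Definition shift_mx (R : pzRingType) : 'M[R]_n := \matrix_(i, j) (i == j.+1 :> nat)%:R.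

(** The columns are the vectors A^j e_1, so over a field invertibility means that e_1 is cyclic for
    A. *)
Definition krylov_mx (R : pzRingType) (A : 'M[R]_n) : 'M[R]_n :=
  \matrix_(i, j) (A ^+ j) i i0.

Lemma shift_mx_exp (R : pzRingType) d i j :
  (shift_mx R ^+ d) i j = (i == j + d :> nat)%N%:R.
Proof.
elim: d i => [|d IH] i; first by rewrite expr0 mxE addn0.
rewrite exprS -mulmxE mxE; case: (posnP i) => [i_0|ip].
  rewrite big1 => [|l _]; first by rewrite i_0 addnS.
  by rewrite mxE i_0 mul0r.
have lt_i : (i.-1 < n)%N by rewrite prednK // ltnW.
rewrite (bigD1 (Ordinal lt_i)) //= mxE /= prednK // eqxx mul1r IH /=.
rewrite big1 => [|l li]; first by rewrite addr0 addnS -(prednK ip).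
rewrite mxE; case: eqP => [e|_]; last by rewrite mul0r.
by case/eqP: li; apply/val_inj; rewrite /= e.
Qed.

Lemma krylov_shift_mx (R : pzRingType) : krylov_mx (shift_mx R) = 1%:M.
Proof. by apply/matrixP => i j; rewrite !mxE shift_mx_exp i0_eq0 add0n. Qed.

Lemma shift_mx_nilpotent (F : fieldType) : nilpotent_mx (shift_mx F).
Proof.
exists n; apply/matrixP => i j; rewrite shift_mx_exp mxE.
by rewrite ltn_eqF // ltn_addl.
Qed.

Section Cyclic.
Variables (F : fieldType) (A : 'M[F]_n).
Hypotheses (A_nil : nilpotent_mx A) (A_cyclic : krylov_mx A \in unitmx).
Local Notation G := (krylov_mx A).

(** A sends each Krylov vector to the next, and the last one to A^n e_1 = 0. *)
Lemma mul_krylov : A *m G = G *m shift_mx F.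
Proof.
apply/matrixP => i j.
have -> : (A *m G) i j = (A ^+ j.+1) i i0.
  by rewrite exprS -mulmxE !mxE; apply: eq_bigr => l _; rewrite mxE.
rewrite mxE; have [lt_j|le_n] := ltnP j.+1 n.
  rewrite (bigD1 (Ordinal lt_j)) //= !mxE eqxx mulr1 big1 ?addr0 // => l lj.
  rewrite !mxE; case: eqP => [e|_]; last by rewrite mulr0.
  by case/eqP: lj; apply/val_inj.
rewrite big1 => [|l _]; last first.
  by rewrite !mxE ltn_eqF ?mulr0 // (leq_trans (ltn_ord l)).
have -> : j.+1 = n by apply/eqP; rewrite eqn_leq le_n ltn_ord.
by rewrite nilpotent_mx_exp // mxE.
Qed.

Lemma cyclic_shift d : A ^+ d = G *m shift_mx F ^+ d *m invmx G.
Proof.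
elim: d => [|d IH]; first by rewrite !expr0 mulmx1 mulmxV.
rewrite exprS -mulmxE IH !mulmxA mul_krylov exprS -mulmxE.
by rewrite !mulmxA.
Qed.

(** The coordinates of B e_1 in the Krylov basis of A. *)
Definition krylov_coef (B : 'M[F]_n) : 'cV[F]_n := invmx G *m col i0 B.

(** Both sides commute with A and agree on e_1, hence on the whole Krylov basis. *)
Lemma cyclic_commutant (B : 'M[F]_n) :
  A *m B = B *m A -> B = \sum_l krylov_coef B l 0 *: A ^+ l.
Proof.
move=> AB; set C := \sum_l _; pose e : 'cV[F]_n := delta_mx i0 0.
have colE' (M : 'M[F]_n) : M *m e = col i0 M by rewrite colE.
have Be : B *m e = C *m e.
  rewrite !colE' -[LHS](mulKVmx A_cyclic) -/(krylov_coef B).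
  apply/colP => i; rewrite !mxE summxE; apply: eq_bigr => l _.
  by rewrite !mxE mulrC.
have AdB d : A ^+ d *m B = B *m A ^+ d by apply/esym/commrX/esym.
have AdC d : A ^+ d *m C = C *m A ^+ d.
  rewrite mulmx_sumr mulmx_suml; apply: eq_bigr => l _.
  by rewrite -scalemxAr -scalemxAl !mulmxE -!exprD addnC.
have colG j : col j G = A ^+ j *m e by rewrite colE'; apply/colP => l; rewrite !mxE.
have BG : B *m G = C *m G.
  apply/matrixP => i j.
  have : col j (B *m G) = col j (C *m G).
    by rewrite !colE -!mulmxA -colE colG !mulmxA -AdB -AdC -!mulmxA Be.
  by move/colP/(_ i); rewrite !mxE.
by rewrite -[B](mulmxK A_cyclic) BG mulmxK.
Qed.

Lemma krylov_coef0 (B : 'M[F]_n) :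
  A *m B = B *m A -> nilpotent_mx B -> krylov_coef B i0 0 = 0.
Proof.
move=> AB [m Bm]; set p := krylov_coef B i0 0.
(* B acts on the line spanned by A ^+ n.-1, which is nonzero, as the scalar p. *)
have BA : B * A ^+ n.-1 = p *: A ^+ n.-1.
  rewrite [B in LHS](cyclic_commutant AB) mulr_suml (bigD1 i0) //= i0_eq0 expr0.
  rewrite -mulmxE -scalemxAl mulmxE mul1r big1 ?addr0 // => l l0.
  rewrite -mulmxE -scalemxAl mulmxE -exprD.
  have ln : (n <= l + n.-1)%N.
    have : (0 < l)%N by rewrite lt0n -i0_eq0.
    by have := ltn_ord l; lia.
  by rewrite -(subnK ln) exprD nilpotent_mx_exp // mulr0 scaler0.
have BmA d : B ^+ d * A ^+ n.-1 = p ^+ d *: A ^+ n.-1.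
  elim: d => [|d IH]; first by rewrite !expr0 mul1r scale1r.
  by rewrite exprSr -mulrA BA -mulmxE -scalemxAr mulmxE IH scalerA -exprS.
have /eqP : p ^+ m *: A ^+ n.-1 = 0 by rewrite -BmA Bm mul0r.
rewrite scaler_eq0 expf_eq0 => /orP[/andP[_ /eqP //]|/eqP An].
(* If A^(n-1) were zero, so would be the last column of the invertible matrix G. *)
have lt_n : (n.-1 < n)%N by have := ltn_ord i0; lia.
have : col (Ordinal lt_n) G = 0 by apply/colP => i; rewrite !mxE An mxE.
rewrite colE => /(congr1 (mulmx (invmx G))); rewrite mulKmx // mulmx0.
by move/matrixP/(_ (Ordinal lt_n) 0)/eqP; rewrite !mxE !eqxx oner_eq0.
Qed.

End Cyclic.

(** The Krylov matrix has first column e_1, leaving n - 1 free columns; each of the two other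
    matrices has n - 1 coefficients, its constant term being zero. *)
Definition cyclic_param : finType := ('I_n * 'I_n.-1 + 'I_2 * 'I_n.-1)%type.

Section Parametrization.
Variable F : fieldType.
Local Notation polyring := {mpoly F[#|cyclic_param|]}.

Definition param_frame : 'M[polyring]_n :=
  \matrix_(i, j) if unlift i0 j is Some l
                  then 'X_(enum_rank (inl (i, l) : cyclic_param)) else (i == i0)%:R.

(** The matrices of the triple in the Krylov basis of the first; the exponents [lift i0 l] run over
    the positive ones. *)
Definition param_mx (a : 'I_3) : 'M[polyring]_n :=
  if unlift 0 a is Some b
  then \sum_l 'X_(enum_rank (inr (b, l) : cyclic_param))
         *: shift_mx polyring ^+ lift i0 l
  else shift_mx polyring.

(* The numerators over the common denominator \det param_frame. *)
Definition param_num (a : 'I_3) : 'M[polyring]_n :=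
  param_frame *m param_mx a *m \adj param_frame.

Lemma map_shift_mx (R S : pzRingType) (f : {rmorphism R -> S}) :
  map_mx f (shift_mx R) = shift_mx S.
Proof. by apply/matrixP => i j; rewrite !mxE rmorph_nat. Qed.

(** Each v a is the conjugate by G of its matrix in the Krylov basis, and the inverse of G is its
    adjugate over its determinant. *)
Lemma cyclic_param_surjective (v : {ffun 'I_3 -> 'M[F]_n}) :
  commuting_nilpotent v -> krylov_mx (v 0) \in unitmx ->
  exists2 u, (\det param_frame).@[u] != 0 &
    forall a i j, v a i j = (param_num a i j).@[u] / (\det param_frame).@[u].
Proof.
move=> [nil comm] cyc; set G := krylov_mx (v 0) in cyc.
pose p a l := krylov_coef (v 0) (v a) l 0.
pose u (t : 'I_#|cyclic_param|) := match enum_val t with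
  | inl (i, l) => G i (lift i0 l)
  | inr (b, l) => p (lift 0 b) (lift i0 l)
  end.
have frameE : map_mx (meval u) param_frame = G.
  apply/matrixP => i j; rewrite mxE mxE; case: unliftP => [l|] ->.
    by rewrite mevalXU /u enum_rankK.
  by rewrite rmorph_nat mxE i0_eq0 expr0 mxE.
have detE : (\det param_frame).@[u] = \det G by rewrite -det_map_mx frameE.
have paramE a : v a = G *m map_mx (meval u) (param_mx a) *m invmx G.
  rewrite /param_mx; case: unliftP => [b|] ->; last first.
    by rewrite map_shift_mx -(expr1 (shift_mx F)) -cyclic_shift ?expr1.
  have comm_b : v 0 *m v (lift 0 b) = v (lift 0 b) *m v 0.
    by apply/subr0_eq/comm.
  rewrite [LHS](cyclic_commutant cyc comm_b) (bigD1_ord i0) //= krylov_coef0 //.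
  rewrite scale0r add0r raddf_sum mulmx_sumr mulmx_suml; apply: eq_bigr => l _ /=.
  rewrite map_mxZ /= mevalXU /u enum_rankK rmorphXn /= map_shift_mx.
  by rewrite -scalemxAr -scalemxAl -cyclic_shift.
exists u => [|a i j]; first by rewrite detE -unitfE -unitmxE.
rewrite detE [in LHS]paramE /invmx cyc -scalemxAr mxE mulrC.
by rewrite -frameE -map_mx_adj -!map_mxM mxE.
Qed.

End Parametrization.
End Krylov.

(** * Reducibility *)

Lemma mxtuple_coordE (F : fieldType) d n (v : {ffun 'I_d -> 'M[F]_n}) a i j :
  mxtuple_coord v (enum_rank (a, i, j)) = v a i j.
Proof. by rewrite /mxtuple_coord enum_rankK. Qed.

Lemma zariski_closed_zero (F : fieldType) d n
    (p : {mpoly F[#|{: 'I_d * 'I_n * 'I_n}|]}) :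
  zariski_closed (fun v => p.@[mxtuple_coord v] = 0).
Proof. by exists (eq p) => v; split=> [? ? <- //|]; apply. Qed.

Lemma zariski_closed_pullback (F : fieldType) d n N (P : {mpoly F[N]})
    (e : 'I_N -> 'I_d * 'I_n * 'I_n) :
  zariski_closed (fun v : {ffun 'I_d -> 'M[F]_n} =>
    P.@[fun t => let: (a, i, j) := e t in v a i j] = 0).
Proof.
have [S hS] := zariski_closed_zero (P \mPo [tuple 'X_(enum_rank (e t)) | t < N]).
exists S => v; rewrite -hS comp_mpoly_meval.
rewrite (@meval_eq _ _ _ (fun t => let: (a, i, j) := e t in v a i j)) // => t.
by rewrite tnth_mktuple mevalXU; case: (e t) => [[a i] j]; rewrite mxtuple_coordE.
Qed.

(** The equation is the Krylov determinant of the generic matrix X, which evaluation specializes to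
    that of v a. *)
Lemma zariski_closed_noncyclic (F : fieldType) d n (i0 : 'I_n) (a : 'I_d) :
  zariski_closed (fun v : {ffun 'I_d -> 'M[F]_n} => \det (krylov_mx i0 (v a)) = 0).
Proof.
pose X := \matrix_(i, j) ('X_(enum_rank (a, i, j)) : {mpoly F[#|{: 'I_d * 'I_n * 'I_n}|]}).
have [S hS] := zariski_closed_zero (\det (krylov_mx i0 X)).
exists S => v; rewrite -hS -det_map_mx.
suff -> : map_mx (meval (mxtuple_coord v)) (krylov_mx i0 X) = krylov_mx i0 (v a) by [].
have XE : map_mx (meval (mxtuple_coord v)) X = v a.
  by apply/matrixP => i j; rewrite !mxE /= mevalXU mxtuple_coordE.
by apply/matrixP => i j; rewrite !mxE -XE -rmorphXn !mxE.
Qed.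

Lemma card_target s : #|target s| = (17 * s * s)%N.
Proof. by rewrite /target !card_sum !card_prod !card_sum !card_ord; lia. Qed.

Lemma card_cyclic_param n : #|cyclic_param n| = ((n + 2) * n.-1)%N.
Proof. by rewrite /cyclic_param card_sum !card_prod !card_ord mulnDl. Qed.

Local Close Scope ring_scope.

Theorem theorem5p2p1 (k : closedFieldType) (s n : nat)
    (hs : 0 < s) (hn : n = 4 * s) (hn16 : 16 <= n) :
  ~ irreducible (@zariski_closed k 3 n) (@commuting_nilpotent k 3 n).
Proof.
have {}hn : n = s + ((s + s) + s) by rewrite hn; lia.
subst n; set n := s + _.
have n0 : 0 < n by apply: leq_trans hn16.
pose i0 : 'I_n := Ordinal n0; have i0E : i0 = 0 :> nat by [].
(* With n = 4 s this reads 16 s^2 + 4 s - 2 < 17 s^2, which holds from s = 4 on. *)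
have lt_card : #|cyclic_param n| < #|target s|.
  by rewrite card_cyclic_param card_target /n; move: hn16; rewrite /n; nia.
pose delta := (\det (param_frame i0 k))%R.
pose g (t : 'I_#|target s|) :=
  let: (a, i, j) := target_entry (enum_val t) in param_num i0 k a i j.
have [P P0 hP] := algebraic_dependence delta g lt_card.
case=> _ /(_ _ _ (zariski_closed_pullback P (fun t => target_entry (enum_val t)))
               (zariski_closed_noncyclic k i0 0%R)) [].
- move=> v vC; have [/eqP|cyc] := eqVneq (\det (krylov_mx i0 (v 0)))%R 0%R.
    by move/eqP; right.
  left; have uG : krylov_mx i0 (v 0%R) \in unitmx by rewrite unitmxE GRing.unitfE.
  have [u du hu] := cyclic_param_surjective i0E vC uG.
  rewrite -[RHS](hP u du); apply: meval_eq => t; rewrite /g.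
  by case: (target_entry _) => [[a i] j].
(* The relation P cannot hold on every triple, since the solutions realize all solvable values of
   the target coordinates. *)
- move=> vanish; case/eqP: P0; apply: generic_target_vanish => c c_solv.
  rewrite -[RHS](vanish _ (solution_commuting c_solv)); apply: meval_eq => t.
  by rewrite (solution_target c_solv) enum_valK.
move=> noncyclic.
(* The Jordan block with two zero matrices is a triple for which e_1 is cyclic. *)
pose v : {ffun 'I_3 -> 'M[k]_n} := [ffun a => if a == 0%R then shift_mx n k else 0%R].
have vC : commuting_nilpotent v.
  split=> [a|a b]; rewrite !ffunE.
    by case: eqP => _; [exact: shift_mx_nilpotent | exists 1; rewrite GRing.expr1].
  by do 2!case: eqP => _; rewrite ?mulmx0 ?mul0mx ?GRing.subrr.
have := noncyclic v vC; rewrite ffunE krylov_shift_mx // det1.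
by move/eqP; rewrite GRing.oner_eq0.
Qed.
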